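(* Let $\theta>0$, let $X$ be the process $SSS(1,\theta)$ on $C$, let $r>0$, and for $x\in C$ let $$M_r(t)=\mathsf{E}_x\, d(x,X(t))^r=\sum_{k=1}^\infty3^{-rk}P_x\bigl(c(x,X(t))=k\bigr),\qquad t\ge0$$ (this does not depend on $x$). 1. If $3^r>\theta$, then $$M_r(t)=\Bigl(\sum_{k=1}^\infty3^{-rk}\theta^k\Bigr)(t+o(t)),\qquad t\downarrow0.$$ 2. If $3^r<\theta$, then $$0<\liminf_{t\downarrow0}\frac{M_r(t)}{t^{\frac{\ln3}{\ln\theta}r}}\le\limsup_{t\downarrow0}\frac{M_r(t)}{t^{\frac{\ln3}{\ln\theta}r}}<\infty.$$
   Context: $C=\{0,1\}^{\mathbb{N}}$ (the triadic Cantor set, with $x=\sum_{k\ge1}2x_k3^{-k}$ identified with $(x_k)_{k\in\mathbb{N}}$), $\mathbb{N}=\{1,2,\dots\}$, with the ultrametric $d(x,y)=3^{-c(x,y)}$, $c(x,y)=\min\{k:x_k\ne y_k\}$, $d(x,x)=0$. For $n\in\mathbb{N}$: $L_n=\{0,1\}^n$, $\pi_nx=(x_1,\dots,x_n)$, and for $v\in L_n$, $x\in C$ with $\pi_nx\ne v$, $c(x,v)=\min\{k:x_k\ne v_k\}$. $\mathcal{C}(C)$ is the space of continuous real functions on $C$ with the sup norm. For $\gamma,\theta\ge0$, $SSS(\gamma,\theta)$ denotes the unique $C$-valued Feller Markov process (with càdlàg paths) whose generator on $\mathcal{C}(C)$ is the closure of the operator $A$ defined on cylindric functions $f=h\circ\pi_n$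 ($n\in\mathbb{N}$, $h:L_n\to\mathbb{R}$) by $$Af(x)=\gamma\sum_{k=1}^n\theta^k\bigl(\langle h\rangle_{n,k,x}-h(\pi_nx)\bigr),\qquad \langle h\rangle_{n,k,x}=2^{-(n-k)}\sum_{v\in L_n:\,c(x,v)=k}h(v).$$ (The closure of $A$ is a Markov generator, so that this process exists and is unique in law for each starting point.) $P_x$ and $\mathsf{E}_x$ denote the law and expectation for the process started at $x$. *)

(* Defs.v *)
From HB Require Import structures.
From mathcomp Require Import all_boot all_order all_algebra.
From mathcomp Require Import all_classical all_reals all_analysis.

Set Implicit Arguments.
Unset Strict Implicit.
Unset Printing Implicit Defensive.

Import Order.TTheory GRing.Theory Num.Theory.
Import numFieldNormedType.Exports.

Local Open Scope classical_set_scope.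
Local Open Scope ring_scope.

(* The coordinates x_1, x_2, ... of x : cantor_space are x 0, x 1, ...: the   *)
(* coordinate x_k is x k.-1. Likewise v_k is nth false v k.-1 for v in L_n.   *)

(* The value 0 stands for the minimum of the empty set; no confusion arises   *)
(* below, where p only holds at positive integers.                            *)
Definition least (p : pred nat) : nat :=
  if pselect (exists k, p k) is left h then ex_minn h else 0%N.

Definition separation_index (x y : cantor_space) : nat :=
  least (fun k => (0 < k)%N && (x k.-1 != y k.-1)).

Definition cylinder_separation_index (n : nat) (x : cantor_space)
    (v : n.-tuple bool) : nat :=
  least (fun k => (0 < k <= n)%N && (x k.-1 != nth false v k.-1)).

Definition cylinder_proj (n : nat) (x : cantor_space) : n.-tuple bool :=
  [tuple x i | i < n].

Section SSS.
Variable R : realType.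

(* This ultrametric induces the product topology, i.e. that of cantor_space.  *)
Definition cantor_dist (x y : cantor_space) : R :=
  if `[< x = y >] then 0 else 3 ^- separation_index x y.

Definition sup_norm (f : cantor_space -> R) : R :=
  sup (range (fun x => `|f x|)).

Definition level_average (n : nat) (h : n.-tuple bool -> R) (k : nat)
    (x : cantor_space) : R :=
  2 ^- (n - k) *
  \sum_(v : n.-tuple bool | cylinder_separation_index x v == k) h v.

(* Operators on the space of continuous functions are represented by graphs. *)
Definition SSS_pregenerator (gamma theta : R) :
    set ((cantor_space -> R) * (cantor_space -> R)) :=
  [set fg | exists n (h : n.-tuple bool -> R),
    [/\ (0 < n)%N,
        fg.1 = (fun x => h (cylinder_proj n x)) &
        fg.2 = (fun x => gamma * \sum_(1 <= k < n.+1)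
          theta ^+ k * (level_average h k x - h (cylinder_proj n x)))]].

Definition operator_closure
    (A : set ((cantor_space -> R) * (cantor_space -> R))) :
    set ((cantor_space -> R) * (cantor_space -> R)) :=
  [set fg | [/\ continuous fg.1, continuous fg.2 &
    forall e : R, 0 < e -> exists2 fg', A fg' &
      sup_norm (fg.1 \- fg'.1) < e /\ sup_norm (fg.2 \- fg'.2) < e]].

(* T t f is meaningful only for 0 <= t and f continuous.                      *)
Record feller_semigroup
    (T : R -> (cantor_space -> R) -> (cantor_space -> R)) : Prop := {
  feller_continuous : forall (t : R) (f : cantor_space -> R),
    0 <= t -> continuous f -> continuous (T t f) ;
  feller_linear : forall (t a : R) (f g : cantor_space -> R),
    0 <= t -> continuous f -> continuous g ->
    T t (fun x => a * f x + g x) = (fun x => a * T t f x + T t g x) ;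
  feller_ge0 : forall (t : R) (f : cantor_space -> R),
    0 <= t -> continuous f ->
    (forall x, 0 <= f x) -> forall x, 0 <= T t f x ;
  feller_cst1 : forall t : R, 0 <= t -> T t (cst 1) = cst 1 ;
  feller_0 : forall f : cantor_space -> R, continuous f -> T 0 f = f ;
  feller_add : forall (s t : R) (f : cantor_space -> R),
    0 <= s -> 0 <= t -> continuous f ->
    T (s + t) f = T s (T t f) ;
  feller_strongly_continuous : forall f : cantor_space -> R, continuous f ->
    sup_norm (T t f \- f) @[t --> 0^'+] --> (0 : R) }.

Definition generator (T : R -> (cantor_space -> R) -> (cantor_space -> R)) :
    set ((cantor_space -> R) * (cantor_space -> R)) :=
  [set fg | [/\ continuous fg.1, continuous fg.2 &
    sup_norm (fun x => (T t fg.1 x - fg.1 x) / t - fg.2 x)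
      @[t --> 0^'+] --> (0 : R)]].

Definition cadlag (w : R -> cantor_space) : Prop :=
  (forall t : R, 0 <= t -> w s @[s --> t^'+] --> w t) /\
  (forall t : R, 0 < t -> cvg (w s @[s --> t^'-])).

Definition natural_filtration (Omega : Type) (X : R -> Omega -> cantor_space)
    (t : R) : set (set Omega) :=
  <<s [set E | exists u U, [/\ 0 <= u <= t, open U & E = X u @^-1` U]] >>.

(* The Markov property E_x[f(X_{t+s}) | F_t] = T_s f(X_t), P_x-almost surely, *)
(* is spelled out through the integrals over the events of F_t.               *)
Record feller_process d (Omega : measurableType d)
    (P : cantor_space -> probability Omega R) (X : R -> Omega -> cantor_space)
    (T : R -> (cantor_space -> R) -> (cantor_space -> R)) : Prop := {
  process_semigroup : feller_semigroup T ;
  process_measurable : forall t : R, 0 <= t ->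
    measurable_fun [set: Omega]
      (X t : Omega -> g_sigma_algebraType (@open cantor_space)) ;
  process_cadlag : forall w, cadlag (fun t => X t w) ;
  process_start : forall x, {ae P x, forall w, X 0 w = x} ;
  process_markov : forall (x : cantor_space) (s t : R) (f : cantor_space -> R)
      (E : set Omega),
    0 <= s -> 0 <= t -> continuous f ->
    natural_filtration X t E ->
    (\int[P x]_(w in E) (f (X (t + s) w))%:E =
     \int[P x]_(w in E) (T s f (X t w))%:E)%E }.

Definition is_SSS (gamma theta : R) d (Omega : measurableType d)
    (P : cantor_space -> probability Omega R)
    (X : R -> Omega -> cantor_space) : Prop :=
  exists2 T, feller_process P X T &
    generator T = operator_closure (SSS_pregenerator gamma theta).

Definition moment d (Omega : measurableType d)
    (P : cantor_space -> probability Omega R) (X : R -> Omega -> cantor_space)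
    (r : R) (x : cantor_space) (t : R) : \bar R :=
  'E_(P x)[fun w => cantor_dist x (X t w) `^ r].

End SSS.

(* Main.v *)
(* For fixed x let u_k be the indicator of the cylinder of level k around x.  *)
(* The Haar function 2 u_k - u_(k-1) is an eigenfunction of the generator     *)
(* with eigenvalue - mu_k, mu_k = theta + ... + theta^(k-1) + 2 theta^k, so   *)
(* that p_k = P_x(c(x, X_t) > k) satisfies 2 p_k - p_(k-1) = exp(- mu_k t).   *)
(* Summation by parts then turns the moment, with a = 3^(-r), into            *)
(*   M_r(t) = (1 - a) / (2 - a) * \sum_(k >= 1) a^k (1 - exp(- mu_k t)).      *)
(* If a theta < 1 then \sum_k a^k mu_k converges and M_r is differentiable    *)
(* at 0. If a theta > 1, the sum is comparable to a^N, where N is the level   *)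
(* with theta^N t <= 1 < theta^(N+1) t, and a = theta^(- r ln 3 / ln theta).  *)
Require Import Defs.
From HB Require Import structures.
From mathcomp Require Import all_boot all_order all_algebra.
From mathcomp Require Import all_classical all_reals all_analysis.
From mathcomp Require Import measurable_realfun ring lra.
Import Order.TTheory GRing.Theory Num.Theory.
Import numFieldNormedType.Exports.
Local Open Scope classical_set_scope.
Local Open Scope ring_scope.

Set Implicit Arguments.
Unset Strict Implicit.
Unset Printing Implicit Defensive.

(** * Haar functions *)

(** The Haar function [haar x k] is a difference of the indicators of two sibling cylinders: jumps
    at coarser levels average it to zero and jumps at its own level flip its sign, so it is an
    eigenfunction of the generator ([haar_pregenerator]), and a Feller semigroup multiplies it by an
    exponential ([semigroup_eigenfunction]). Evaluation at x gives a two-term recursion for the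
    probabilities of staying in a cylinder ([survivalS]), and summation by parts solves it for the
    moment ([moment_escape_sum]). Only the rates [haar_rate] survive, whence the independence of x.

    What remains is the behaviour at small t of the sum of a^k (1 - exp(- mu_k t)). If a theta < 1,
    the derivatives at 0 are summable and the sum is linear to first order ([escape_sum_linear]). If
    a theta > 1, the levels with theta^k t small contribute a growing geometric sum, the finer
    levels a decaying one; both have the size of the term at the crossover level
    ([escape_sum_scale]), which is a power of t ([escape_sum_powR]). *)

Lemma least_eqE (p : pred nat) (k : nat) : (0 < k)%N ->
  (least p == k) = p k && all (fun i => ~~ p i) (iota 0 k).
Proof.
move=> k0; rewrite /least; case: pselect => [h|h].
  case: ex_minnP => m pm mmin; apply/eqP/andP => [<-|[pk /allP npk]].
    split=> //; apply/allP => i; rewrite mem_iota add0n => /andP[_ im].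
    by apply: contraL im => /mmin; rewrite -leqNgt.
  apply/eqP; rewrite eqn_leq mmin// leqNgt; apply/negP => mk.
  by have := npk m; rewrite mem_iota/= add0n pm => /(_ mk).
apply/eqP/andP => [k_eq|[pk _]]; first by rewrite -k_eq in k0.
by case: h; exists k.
Qed.

(** Stated for bare functions, so as to apply both to points of the Cantor space and to
    [nth false v] for a tuple v. *)
Definition agree (n : nat) (x y : nat -> bool) : bool :=
  all (fun i => x i == y i) (iota 0 n).

Lemma agreeS (n : nat) (x y : nat -> bool) :
  agree n.+1 x y = agree n x y && (x n == y n).
Proof. by rewrite /agree -addn1 iotaD all_cat/= andbT. Qed.

Lemma agreeP (n : nat) (x y : nat -> bool) :
  reflect (forall i, (i < n)%N -> x i = y i) (agree n x y).
Proof.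
apply: (iffP allP) => [h i lin|h i].
  by apply/eqP/h; rewrite mem_iota add0n.
by rewrite mem_iota add0n => /h/eqP.
Qed.

Lemma eq_agree (n : nat) (x y z : nat -> bool) :
  (forall i, (i < n)%N -> y i = z i) -> agree n x y = agree n x z.
Proof.
by move=> yz; apply: eq_in_all => i; rewrite mem_iota add0n => /yz ->.
Qed.

Lemma agreeC (n : nat) (x y : nat -> bool) : agree n x y = agree n y x.
Proof. by apply: eq_all => i; rewrite eq_sym. Qed.

(** The shift comes from numbering: level k+1 is the coordinate stored at index k. *)
Lemma separation_indexE (x y : cantor_space) (k : nat) :
  (separation_index x y == k.+1) = agree k x y && (x k != y k).
Proof.
rewrite /separation_index least_eqE//= andbC; congr (_ && _).
rewrite -[1%N]addn0 iotaDl all_map; apply: eq_all => i /=.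
by rewrite negbK.
Qed.

Lemma cylinder_separation_indexE (n : nat) (x : cantor_space)
    (v : n.-tuple bool) (k : nat) : (k < n)%N ->
  (cylinder_separation_index x v == k.+1) =
  agree k x (nth false v) && (x k != nth false v k).
Proof.
move=> kn; rewrite /cylinder_separation_index least_eqE//= kn andbC.
congr (_ && _); rewrite -[1%N]addn0 iotaDl all_map; apply: eq_in_all => i /=.
rewrite mem_iota add0n => /andP[_ ik].
by rewrite negb_and negbK add1n/= (leq_trans ik (ltnW kn)).
Qed.

Lemma nth_mktuple_nat (n : nat) (x : nat -> bool) (i : nat) : (i < n)%N ->
  nth false [tuple x j | j < n] i = x i.
Proof.
by move=> lin; rewrite -[i]/(val (Ordinal lin)) -tnth_nth tnth_mktuple.
Qed.

Lemma eq_mktuple_agree (n : nat) (x y : nat -> bool) :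
  ([tuple x j | j < n] == [tuple y j | j < n]) = agree n x y.
Proof.
apply/eqP/agreeP => [xy i lin|xy].
  by rewrite -(nth_mktuple_nat x lin) xy nth_mktuple_nat.
by apply: eq_from_tnth => i; rewrite !tnth_mktuple xy.
Qed.

Section Haar.
Variable R : realType.

Definition cylinder_ind (x : cantor_space) (k : nat) (y : cantor_space) : R :=
  (agree k x y)%:R.

(* Indices are shifted by one: haar x k and haar_rate theta k have level k+1. *)
Definition haar (x : cantor_space) (k : nat) (y : cantor_space) : R :=
  2 * cylinder_ind x k.+1 y - cylinder_ind x k y.

Definition haar_rate (theta : R) (k : nat) : R :=
  \sum_(1 <= j < k.+1) theta ^+ j + 2 * theta ^+ k.+1.

Lemma haar_rate_gt (theta : R) (k : nat) : 0 < theta ->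
  theta ^+ k.+1 < haar_rate theta k.
Proof.
move=> th0; rewrite /haar_rate.
have : 0 <= \sum_(1 <= j < k.+1) theta ^+ j.
  by apply: sumr_ge0 => j _; rewrite exprn_ge0// ltW.
have : 0 < theta ^+ k.+1 by rewrite exprn_gt0.
lra.
Qed.

Lemma haar_rate_gt0 (theta : R) (k : nat) : 0 < theta -> 0 < haar_rate theta k.
Proof.
by move=> th0; rewrite (lt_trans _ (haar_rate_gt k th0))// exprn_gt0.
Qed.

Lemma cylinder_ind_continuous (x : cantor_space) (k : nat) :
  continuous (cylinder_ind x k).
Proof.
elim: k => [|k IHk]; first exact: cst_continuous.
have -> : cylinder_ind x k.+1 =
    (fun y => cylinder_ind x k y * (x k == y k)%:R).
  by apply/funext => y; rewrite /cylinder_ind agreeS -mulnb natrM.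
move=> y; apply: continuousM; first exact: IHk.
apply: (@continuous_comp _ _ _ (fun y : cantor_space => y k)
          (fun b : bool => (x k == b)%:R : R)).
  exact: proj_continuous.
move: (y k); apply/continuousP => A _; exact: discrete_open.
Qed.

Lemma haar_continuous (x : cantor_space) (k : nat) : continuous (haar x k).
Proof.
move=> y; apply: (@continuousB _ _ _ (fun y => 2 * cylinder_ind x k.+1 y)).
  2: exact: cylinder_ind_continuous.
by apply: continuousM; [exact: cst_continuous|exact: cylinder_ind_continuous].
Qed.

(** The classical form: +1 on the half of the level-k cylinder that contains x, -1 on the other
    half, 0 elsewhere. *)
Lemma haarE (x : cantor_space) (k : nat) (y : cantor_space) :
  haar x k y =
  (agree k x y && (x k == y k))%:R - (agree k x y && (x k != y k))%:R.
Proof.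
rewrite /haar /cylinder_ind agreeS.
by case: (agree k x y); case: (x k == y k) => /=; rewrite ?mulr1n ?mulr0n; ring.
Qed.

Lemma sum_indic_diff (T : finType) (Q : pred T) (v0 v1 : T) :
  \sum_(v | Q v) ((v == v0)%:R - (v == v1)%:R) = (Q v0)%:R - (Q v1)%:R :> R.
Proof.
have sum1 v' : \sum_(v | Q v) (v == v')%:R = (Q v')%:R :> R.
  rewrite big_mkcond (bigD1 v')//= big1 ?addr0 ?eqxx => [|v /negbTE ->].
    by case: ifP.
  by rewrite if_same.
by rewrite sumrB !sum1.
Qed.

(** On words of length k+1 the function is a point mass at [v0], the prefix of x, minus one at [v1],
    the same word with its last letter flipped. Each level up to k has average 0 and contributes -
    theta^j; level k+1 exchanges [v0] and [v1] and contributes - 2 theta^(k+1). *)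
Lemma haar_pregenerator (theta : R) (x : cantor_space) (k : nat) :
  SSS_pregenerator 1 theta
    (haar x k, fun y => - haar_rate theta k * haar x k y).
Proof.
pose flip (i : nat) := x i (+) (i == k).
pose v0 := [tuple x j | j < k.+1]; pose v1 := [tuple flip j | j < k.+1].
pose h (v : k.+1.-tuple bool) : R := (v == v0)%:R - (v == v1)%:R.
have flipE i : (i < k)%N -> flip i = x i.
  by move=> ik; rewrite /flip ltn_eqF// addbF.
have flipk : flip k = ~~ x k by rewrite /flip eqxx addbT.
have hE y : h (cylinder_proj k.+1 y) = haar x k y.
  rewrite haarE /h !eq_mktuple_agree !agreeS -!(agreeC k x).
  rewrite agreeC (eq_agree y flipE) agreeC flipk.
  by rewrite [y k == x k]eq_sym; case: (x k); case: (y k).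
have hsum j y : (j <= k)%N ->
    level_average h j.+1 y = (j == k)%:R * - haar x k y.
  rewrite leq_eqVlt /level_average sum_indic_diff => /orP[/eqP ->|jk].
    rewrite !cylinder_separation_indexE//.
    rewrite !(@eq_agree k _ (nth false _) x); last 2 first.
    - by move=> i ik; rewrite nth_mktuple_nat ?flipE// ltnS ltnW.
    - by move=> i ik; rewrite nth_mktuple_nat// ltnS ltnW.
    rewrite !nth_mktuple_nat// flipk subnn expr0 invr1 eqxx !mul1r.
    rewrite haarE opprB agreeC. rewrite [y k == x k]eq_sym.
    by case: (x k); case: (y k).
  (* At a coarser level [v0] and [v1] lie in the same sphere around y or both outside it, so their
     masses cancel. *)
  rewrite !cylinder_separation_indexE ?(ltnW jk) ?(ltn_trans jk)//.
  rewrite !(@eq_agree j _ (nth false _) x); last 2 first.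
  - move=> i ij; have ik := ltn_trans ij jk.
    by rewrite nth_mktuple_nat ?flipE// (ltn_trans ik).
  - by move=> i ij; rewrite nth_mktuple_nat// (ltn_trans (ltn_trans ij jk)).
  rewrite !nth_mktuple_nat ?(ltn_trans jk)// flipE// subrr mulr0.
  by rewrite (ltn_eqF jk) mul0r.
exists k.+1, h; split => //=; first by apply/funext => y; rewrite hE.
apply/funext => y; rewrite mul1r big_nat_recr//= hsum// hE eqxx mul1r.
rewrite (eq_big_nat _ _ (F2 := fun j => theta ^+ j * - haar x k y)).
  by rewrite -mulr_suml /haar_rate; ring.
move=> [//|j] /andP[_]; rewrite ltnS => jk; rewrite hsum ?(ltnW jk)//.
by rewrite (ltn_eqF jk) mul0r add0r.
Qed.
End Haar.

(** * Eigenfunctions of a Feller semigroup *)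

Section Semigroup.
Variable R : realType.
Implicit Types (f g : cantor_space -> R) (M : R).

Lemma cantor_continuous_bounded f : continuous f ->
  exists M, forall x, `|f x| <= M.
Proof.
move=> cf.
have : compact [set `|f x| | x in [set: cantor_space]].
  apply: continuous_compact cantor_space_compact.
  apply: continuous_subspaceT => x.
  by apply: (@continuous_comp _ _ _ f (fun r => `|r|));
    [exact: cf|exact: norm_continuous].
move=> /compact_bounded[M [_ /(_ (M + 1))]].
rewrite ltrDl ltr01 => /(_ isT) Mf; exists (M + 1) => x.
by have := Mf _ (imageP _ (I : [set: cantor_space] x)); rewrite /= normr_id.
Qed.

(** The uniform bound is there because [sup] of an unbounded set is a default value. *)
Lemma norm_le_sup_norm f M : (forall y, `|f y| <= M) ->
  forall x, `|f x| <= sup_norm f.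
Proof.
move=> fM x; apply: ub_le_sup; last by exists x.
by exists M => _ [y _ <-].
Qed.

Lemma sup_norm_subrr f : sup_norm (f \- f) = 0.
Proof.
rewrite /sup_norm [X in sup X](_ : _ = [set 0]) ?sup1//.
apply/seteqP; split => [_ [x _ <-]|_ ->]/=; first by rewrite subrr normr0.
by exists point => //; rewrite subrr normr0.
Qed.

Lemma sub_operator_closure (A : set ((cantor_space -> R) * (cantor_space -> R)))
    f g : continuous f -> continuous g -> A (f, g) -> operator_closure A (f, g).
Proof.
move=> cf cg Afg; split => // e e0; exists (f, g) => //=.
by rewrite !sup_norm_subrr.
Qed.

Variable T : R -> (cantor_space -> R) -> (cantor_space -> R).
Hypothesis FT : feller_semigroup T.

Lemma feller_cst (t M : R) : 0 <= t -> T t (cst M) = cst M.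
Proof.
move=> t0.
have c1 : continuous (cst 1 : cantor_space -> R) by exact: cst_continuous.
have := feller_linear FT (M - 1) t0 c1 c1; rewrite !(feller_cst1 FT)//= => TM.
(* [feller_linear] scales only its first function, hence this way of writing M. *)
have -> : cst M = (fun _ : cantor_space => (M - 1) * 1 + 1).
  by apply/funext => x; rewrite mulr1 subrK.
exact: TM.
Qed.

(** Positivity of the semigroup, applied to M + f and M - f. *)
Lemma feller_contraction (t : R) f M : 0 <= t -> continuous f ->
  (forall y, `|f y| <= M) -> forall x, `|T t f x| <= M.
Proof.
move=> t0 cf fM x.
have cM : continuous (cst M : cantor_space -> R) by exact: cst_continuous.
have sg (a : R) : `|a| = 1 -> 0 <= a * T t f x + M.
  move=> a1; have := feller_linear FT a t0 cf cM.
  rewrite (feller_cst _ t0) => /(congr1 (fun F => F x)) /= <-.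
  apply: (feller_ge0 FT) => // [y|y].
    apply: (@continuousD _ _ _ (fun y => a * f y) (cst M)); last exact: cM.
    by apply: continuousM; [exact: cst_continuous|exact: cf].
  rewrite -lerBlDr sub0r lerNl.
  by rewrite (le_trans (ler_norm _))// normrN normrM a1 mul1r.
rewrite ler_norml; have := sg 1 (normr1 _); have := sg (-1) (normrN1 _).
by rewrite mulN1r mul1r => h1 h2; apply/andP; split; lra.
Qed.

(** The upper bound follows from exp(-u) <= 1 / (1 + u), as 1 / (1 + u) - 1 + u = u^2 / (1 + u). *)
Lemma expRN_le (u : R) : 0 <= u -> 0 <= expR (- u) - 1 + u <= u ^+ 2.
Proof.
move=> u0; have := expR_ge1Dx (- u); have := expR_ge1Dx u => h1 h2.
rewrite expRN; apply/andP; split; first by rewrite -expRN; lra.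
have u1 : 0 < 1 + u by lra.
apply: (@le_trans _ _ ((1 + u)^-1 - 1 + u)).
  by rewrite !lerD2r lef_pV2// posrE expR_gt0.
rewrite -subr_ge0.
have -> : u ^+ 2 - ((1 + u)^-1 - 1 + u) = u ^+ 3 / (1 + u) by field; lra.
by rewrite divr_ge0 ?exprn_ge0// ltW.
Qed.

(** One-step errors only add up: later steps do not amplify them, since the semigroup is a
    contraction and exp(- mu h) <= 1. *)
Lemma semigroup_iter_le (mu h e : R) f : 0 <= mu -> 0 <= h -> continuous f ->
  (forall y, `|T h f y - expR (- (mu * h)) * f y| <= e) ->
  forall n y,
    `|T (n%:R * h) f y - expR (- (mu * (n%:R * h))) * f y| <= n%:R * e.
Proof.
move=> mu0 h0 cf eh; have nh0 n : 0 <= n%:R * h by rewrite mulr_ge0.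
pose D y := T h f y - expR (- (mu * h)) * f y.
have cTf : continuous (T h f) by apply: (feller_continuous FT).
have cD : continuous D.
  move=> y; apply: (@continuousB _ _ _ (T h f)); first exact: cTf.
  by apply: continuousM; [exact: cst_continuous|exact: cf].
elim=> [|n IHn] y.
  by rewrite !mul0r mulr0 oppr0 expR0 mul1r (feller_0 FT)// subrr normr0.
have -> : T (n.+1%:R * h) f y =
    expR (- (mu * h)) * T (n%:R * h) f y + T (n%:R * h) D y.
  rewrite -natr1 mulrDl mul1r (feller_add FT)//.
  have := feller_linear FT (expR (- (mu * h))) (nh0 n) cf cD.
  move=> /(congr1 (fun F => F y)) /= <-; congr (T _ _ y).
  by apply/funext => z; rewrite /D subrKC.
have -> : expR (- (mu * (n.+1%:R * h))) =
    expR (- (mu * h)) * expR (- (mu * (n%:R * h))).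
  by rewrite -expRD -natr1; congr expR; ring.
rewrite addrAC -mulrA -mulrBr -natr1 mulrDl mul1r (le_trans (ler_normD _ _))//.
apply: lerD; last exact: feller_contraction.
rewrite normrM ger0_norm ?expR_ge0// -[leRHS]mul1r ler_pM ?expR_ge0//.
by rewrite expR_le1 oppr_le0 mulr_ge0.
Qed.

(* T_t f - e^(-mu t) f telescopes into n increments over steps t / n, each of *)
(* which is o(t / n) because f is an eigenfunction of the generator.          *)
Lemma semigroup_eigenfunction (mu : R) f : 0 <= mu ->
  generator T (f, fun y => - mu * f y) ->
  forall (t : R) y, 0 <= t -> T t f y = expR (- (mu * t)) * f y.
Proof.
move=> mu0 [/= cf cg gen] t y t0.
have [M fM] := cantor_continuous_bounded cf.
have M0 : 0 <= M by apply: le_trans (fM y).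
move: t0; rewrite le_eqVlt => /predU1P[<-|t0].
  by rewrite mulr0 oppr0 expR0 mul1r (feller_0 FT).
apply/eqP; rewrite -subr_eq0 -normr_le0.
apply/ler_addgt0Pl => e e0; rewrite addr0.
(* The n steps of length h = t / n each cost at most h (e' + M mu^2 e'), in total C e' <= e. *)
pose C := t * (1 + M * mu ^+ 2); have C0 : 0 <= C.
  by rewrite mulr_ge0 ?(ltW t0)// addr_ge0// mulr_ge0// exprn_ge0.
pose e' := e / (C + 1); have e'0 : 0 < e' by rewrite divr_gt0// ltr_pwDr.
have : \forall h \near 0^'+, [/\ 0 < h, h <= e' &
    sup_norm (fun x => (T h f x - f x) / h - - mu * f x) <= e'].
  near=> h; split.
  - by near: h; exact: nbhs_right_gt.
  - by near: h; exact: nbhs_right_le.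
  rewrite (le_trans (ler_norm _))//; near: h.
  by move/cvgr0Pnorm_le : gen; exact.
rewrite near_withinE => /nbhs_ballP[r /= r0 hr].
pose n := (Num.bound (t / r)).+1.
have n0 : 0 < n%:R :> R by rewrite ltr0n.
have tn : t / n%:R < r.
  rewrite ltr_pdivrMr// mulrC -ltr_pdivrMr//.
  rewrite (lt_trans (archi_boundP _)) ?ltr_nat// divr_ge0 ?ltW//.
pose h := t / n%:R; have h0 : 0 < h by rewrite divr_gt0.
have [//|//|_ he hsup] := hr h.
  by rewrite /ball/= sub0r normrN gtr0_norm.
have TM x : `|T h f x| <= M by apply: feller_contraction => //; exact: ltW.
have step z : `|T h f z - expR (- (mu * h)) * f z| <=
    h * (e' + M * mu ^+ 2 * e').
  (* The first term is the error in the generator limit, the second the Taylor error of the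
     exponential, of order h^2 and absorbed because h <= e'. *)
  have -> : T h f z - expR (- (mu * h)) * f z =
      h * ((T h f z - f z) / h - - mu * f z)
      - (expR (- (mu * h)) - 1 + mu * h) * f z.
    by field; rewrite gt_eqF.
  rewrite (le_trans (ler_normB _ _))// [leRHS]mulrDr lerD//.
    rewrite normrM gtr0_norm// ler_wpM2l ?(ltW h0)//.
    apply: le_trans hsup; move: z.
    apply: (@norm_le_sup_norm (fun z => (T h f z - f z) / h - - mu * f z)
      ((M + M) / h + mu * M)) => z.
    rewrite (le_trans (ler_normB _ _))// lerD//.
      rewrite normrM [`|h^-1|]gtr0_norm ?invr_gt0//.
      rewrite ler_wpM2r ?invr_ge0 ?(ltW h0)//.
      by rewrite (le_trans (ler_normB _ _))// lerD.
    by rewrite normrM normrN (ger0_norm mu0) ler_wpM2l.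
  have /andP[l1 l2] := expRN_le (mulr_ge0 mu0 (ltW h0)).
  rewrite normrM (ger0_norm l1).
  apply: (@le_trans _ _ ((mu * h) ^+ 2 * M)); first by rewrite ler_pM.
  have -> : (mu * h) ^+ 2 * M = h * (M * mu ^+ 2 * h) by ring.
  by rewrite ler_wpM2l ?(ltW h0)// ler_wpM2l// mulr_ge0 ?exprn_ge0.
have := semigroup_iter_le mu0 (ltW h0) cf step n y.
have nh : n%:R * h = t by rewrite /h mulrC divfK// gt_eqF.
rewrite nh => /le_trans; apply.
have -> : n%:R * (h * (e' + M * mu ^+ 2 * e')) = C * e' by rewrite /C -nh; ring.
rewrite /e' mulrC -mulrA ler_piMr ?(ltW e0)//.
by rewrite ler_pdivrMl ?mulr1 ?lerDl ?ltr_wpDl.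
Unshelve. all: by end_near.
Qed.
End Semigroup.

(** * Law of the separation index *)

Lemma separation_index_eq0 (x y : cantor_space) :
  separation_index x y = 0%N -> x = y.
Proof.
rewrite /separation_index /least; case: pselect => [h|h _].
  by case: ex_minnP => m /andP[m0 _] _ m_eq; rewrite m_eq in m0.
apply/funext => k; apply: contrapT => /eqP xyk; apply: h.
by exists k.+1.
Qed.

(** For y different from x exactly one term of the series is nonzero; for y = x none is, and 0^r = 0
    because r > 0. *)
Lemma cantor_dist_powR (R : realType) (x y : cantor_space) (r : R) : 0 < r ->
  ((cantor_dist R x y `^ r)%:E =
   \sum_(0 <= k <oo) (3 `^ (- (r * k.+1%:R)))%:E *
     (separation_index x y == k.+1)%:R%:E)%E.
Proof.
move=> r0; rewrite /cantor_dist; case: asboolP => [->|xy].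
  rewrite powR0 ?gt_eqF// eseries0// => k _ _.
  by rewrite separation_indexE eqxx andbF mule0.
case sep : (separation_index x y) => [|m].
  by move/separation_index_eq0: sep.
rewrite (@nneseriesD1 _ _ m)//.
rewrite eqxx mule1 eseries0 ?adde0 => [|k _ /negbTE km].
  by rewrite -powR_invn ?ler0n// -powRrM mulNr mulrC.
by rewrite eqSS eq_sym km mule0.
Qed.

Section Process.
Context (R : realType) (d : measure_display) (Omega : measurableType d).
Variables (P : cantor_space -> probability Omega R).
Variables (X : R -> Omega -> cantor_space).
Variables (T : R -> (cantor_space -> R) -> (cantor_space -> R)).
Hypothesis FP : feller_process P X T.
Let FT := process_semigroup FP.

Lemma measurable_process (t : R) (f : cantor_space -> R) : 0 <= t ->
  continuous f -> measurable_fun [set: Omega] (fun w => f (X t w)).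
Proof.
move=> t0 cf; apply: (measurability _ (RGenOpens.measurableE R)).
move=> _ [_ [a [b ->] <-]].
apply: (process_measurable FP t0 measurableT (Y := f @^-1` `]a, b[%classic)).
apply: sub_sigma_algebra; move/continuousP : cf; apply.
exact: interval_open.
Qed.

(** The Markov property from time 0, over the whole space, together with X_0 = x almost surely. *)
Lemma integral_process (x : cantor_space) (t : R) (f : cantor_space -> R) :
  0 <= t -> continuous f -> (\int[P x]_w (f (X t w))%:E = (T t f x)%:E)%E.
Proof.
move=> t0 cf.
have ET : natural_filtration X 0 [set: Omega].
  by move=> S [[S0 SC _] _]; rewrite -(setD0 setT); exact: SC.
have := process_markov FP x t0 (lexx 0) cf ET; rewrite add0r => ->.
have cTf := feller_continuous FT t0 cf.
rewrite (ae_eq_integral (fun=> (T t f x)%:E))//.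
- by rewrite integral_cst//= probability_setT mule1.
- by apply/measurable_EFinP; exact: measurable_process.
- by apply: filterS (process_start FP x) => w /= ->.
Qed.

(* survival x t k is the probability that c(x, X t) > k under P x.            *)
Definition survival (x : cantor_space) (t : R) (k : nat) : R :=
  T t (cylinder_ind R x k) x.

Lemma survival0 (x : cantor_space) (t : R) : 0 <= t -> survival x t 0 = 1.
Proof.
by move=> t0; rewrite /survival -[cylinder_ind R x 0]/(cst 1) (feller_cst1 FT).
Qed.

Lemma survival_itv (x : cantor_space) (t : R) (k : nat) : 0 <= t ->
  0 <= survival x t k <= 1.
Proof.
move=> t0; apply/andP; split.
  by apply: (feller_ge0 FT) => //; exact: cylinder_ind_continuous.
rewrite (le_trans (ler_norm _))//.
apply: (feller_contraction FT) => //; first exact: cylinder_ind_continuous.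
by move=> y; rewrite normr_nat lern1 leq_b1.
Qed.

Lemma separation_set_ind (x y : cantor_space) (k : nat) :
  (separation_index x y == k.+1)%:R =
  -1 * cylinder_ind R x k.+1 y + cylinder_ind R x k y.
Proof.
rewrite separation_indexE /cylinder_ind agreeS.
by case: agree; case: (x k == y k) => /=; rewrite ?mulr1n ?mulr0n; ring.
Qed.

(** The indicator of the event is a continuous function of [X t w], since cylinders are open and
    closed; its expectation is therefore given by the semigroup. *)
Lemma separation_process (x : cantor_space) (t : R) (k : nat) : 0 <= t ->
  measurable [set w | separation_index x (X t w) = k.+1] /\
  P x [set w | separation_index x (X t w) = k.+1] =
    (survival x t k - survival x t k.+1)%:E.
Proof.
move=> t0; set E := [set w | _].
have cc j : continuous (cylinder_ind R x j) by exact: cylinder_ind_continuous.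
pose f y := -1 * cylinder_ind R x k.+1 y + cylinder_ind R x k y.
have cf : continuous f.
  move=> y; apply: (@continuousD _ _ _ (fun y => -1 * cylinder_ind R x k.+1 y)).
    2: exact: cc.
  by apply: continuousM; [exact: cvg_cst|exact: cc].
have EE : E = setT `&` (fun w => f (X t w)) @^-1` [set 1].
  rewrite setTI; apply/seteqP; split => w /=; rewrite /f -separation_set_ind.
    by move=> ->; rewrite eqxx.
  by case: eqP => // _ /eqP; rewrite eq_sym oner_eq0.
have mE : measurable E by rewrite EE; apply: measurable_process.
split => //; rewrite -[E]setIT -integral_indic//.
have -> : survival x t k - survival x t k.+1 = T t f x.
  by rewrite (feller_linear FT)// mulN1r addrC.
rewrite -integral_process//; apply: eq_integral => w _; congr _%:E.
rewrite indicE /f -separation_set_ind; congr ((nat_of_bool _)%:R).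
by apply/idP/eqP; rewrite inE.
Qed.

Lemma moment_series (r : R) (x : cantor_space) (t : R) : 0 < r -> 0 <= t ->
  moment P X r x t = (\sum_(1 <= k <oo) (3 `^ (- (r * k%:R)))%:E *
     P x [set w | separation_index x (X t w) = k])%E.
Proof.
move=> r0 t0; rewrite /moment unlock.
under eq_integral do rewrite cantor_dist_powR//.
have indE k w : (separation_index x (X t w) == k.+1)%:R =
    \1_[set w | separation_index x (X t w) = k.+1] w :> R.
  by rewrite indicE; congr ((nat_of_bool _)%:R); apply/eqP/idP; rewrite inE.
rewrite integral_nneseries//; last first.
  move=> k; apply: emeasurable_funM => //; apply/measurable_EFinP.
  under eq_fun do rewrite indE.
  by apply: measurable_indic; have [] := separation_process x k t0.
rewrite -[RHS](@nneseries_addn _ _ 1%N) => [|k]; last first.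
  by apply: mule_ge0 => //; rewrite lee_fin powR_ge0.
apply: eq_eseriesr => k _; rewrite addn1.
have [mE _] := separation_process x k t0.
under eq_integral do rewrite indE.
rewrite integralZl//; last first.
  by apply: integrable_indic.
by rewrite integral_indic// setIT.
Qed.

Variable theta : R.
Hypothesis theta0 : 0 < theta.
Hypothesis genT : generator T = operator_closure (SSS_pregenerator 1 theta).

Lemma survivalS (x : cantor_space) (t : R) (k : nat) : 0 <= t ->
  2 * survival x t k.+1 - survival x t k = expR (- (haar_rate theta k * t)).
Proof.
move=> t0.
have cc j : continuous (cylinder_ind R x j) by exact: cylinder_ind_continuous.
have ch := @haar_continuous R x k.
have genh :
    generator T (haar R x k, fun y => - haar_rate theta k * haar R x k y).
  rewrite genT; apply: sub_operator_closure => //.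
    2: exact: haar_pregenerator.
  move=> y; apply: (@continuousM _ _ (cst (- haar_rate theta k)) (haar R x k)).
    exact: cst_continuous.
  exact: ch.
have := semigroup_eigenfunction FT (ltW (haar_rate_gt0 k theta0)) genh x t0.
have -> : haar R x k x = 1.
  have agreexx j : agree j x x = true by apply/agreeP.
  by rewrite /haar /cylinder_ind !agreexx/= mulr1n; ring.
rewrite mulr1 => <-.
(* The identity haar + u_k = u_(k+1) + u_(k+1) is pushed through the semigroup, each side in the
   shape that [feller_linear] accepts. *)
have := feller_linear FT 1 t0 (cc k.+1) (cc k.+1).
have := feller_linear FT 1 t0 ch (cc k).
have -> : (fun y => 1 * haar R x k y + cylinder_ind R x k y) =
    (fun y => 1 * cylinder_ind R x k.+1 y + cylinder_ind R x k.+1 y).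
  by apply/funext => y; rewrite /haar; ring.
move=> -> /(congr1 (fun F => F x)) /=; rewrite /survival; lra.
Qed.
End Process.

(** * Small time asymptotics *)

Section Asymptotics.
Variable R : realType.
Implicit Types (a b c theta t : R) (p : nat -> R).

Lemma sum_exprS c m n : (m <= n)%N ->
  (c - 1) * \sum_(m <= k < n) c ^+ k.+1 = c ^+ n.+1 - c ^+ m.+1.
Proof.
move=> mn; rewrite mulr_sumr -(telescope_sumr (fun k => c ^+ k.+1))//.
by apply: eq_bigr => k _; rewrite mulrBl mul1r -exprS.
Qed.

(** With q = 1 - p, the differences are p_k - p_(k+1) = q_(k+1) - q_k and 1 - E_k = 2 q_(k+1) - q_k.
    As q_0 = 0, up to boundary terms both sums are multiples of the sum of a^k q_k, with factors 1 -
    a and 2 - a. *)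
Lemma sum_halving a p (E : nat -> R) : p 0%N = 1 ->
  (forall k, 2 * p k.+1 - p k = E k) -> forall n,
  (2 - a) * (\sum_(0 <= k < n) a ^+ k.+1 * (p k - p k.+1)) =
  (1 - a) * (\sum_(0 <= k < n) a ^+ k.+1 * (1 - E k)) + a ^+ n.+1 * (1 - p n).
Proof.
move=> p0 pE; elim=> [|n IHn]; first by rewrite !big_geq// p0; ring.
by rewrite !big_nat_recr//= !mulrDr IHn -pE !exprS; ring.
Qed.

Lemma expr_cvg0 a : 0 < a < 1 -> a ^+ n @[n --> \oo] --> 0.
Proof. by move=> /andP[a0 a1]; apply: cvg_expr; rewrite gtr0_norm. Qed.

Lemma cvg_sum_halving a p (E : nat -> R) : 0 < a < 1 -> p 0%N = 1 ->
  (forall k, 0 <= p k <= 1) -> (forall k, 2 * p k.+1 - p k = E k) ->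
  forall l, series (fun k => a ^+ k.+1 * (1 - E k)) n @[n --> \oo] --> l ->
  series (fun k => a ^+ k.+1 * (p k - p k.+1)) n @[n --> \oo] -->
    (1 - a) / (2 - a) * l.
Proof.
move=> a01 p0 p01 pE l ul; have /andP[a0 a1] := a01.
have a2 : 2 - a != 0 by lra.
have -> : series (fun k => a ^+ k.+1 * (p k - p k.+1)) =
    (fun n => (1 - a) / (2 - a) * series (fun k => a ^+ k.+1 * (1 - E k)) n +
      a ^+ n * (a / (2 - a) * (1 - p n))).
  apply/funext => n; apply: (mulfI a2).
  by rewrite /series/= (sum_halving _ p0 pE) exprS; field.
rewrite -[X in _ --> X]addr0; apply: cvgD.
  by apply: cvgM => //; exact: cvg_cst.
apply: (@squeeze_cvgr _ _ _ _ (fun=> 0) (fun n => a ^+ n)).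
- near=> n; have /andP[pn0 pn1] := p01 n.
  have an0 : 0 <= a ^+ n by rewrite exprn_ge0// ltW.
  have q0 : 0 <= a / (2 - a) by rewrite divr_ge0; lra.
  have q1 : a / (2 - a) <= 1 by rewrite ler_pdivrMr; lra.
  have q2 : 0 <= a / (2 - a) * (1 - p n) by rewrite mulr_ge0// subr_ge0.
  have q3 : a / (2 - a) * (1 - p n) <= 1 by apply: mulr_ile1 => //; lra.
  by rewrite mulr_ge0//= ler_piMr.
- exact: cvg_cst.
- exact: expr_cvg0.
Unshelve. all: by end_near.
Qed.

(** For a = 3^(-r) its limit is the moment at time t up to the factor (1 - a) / (2 - a). *)
Definition escape_series a theta t : nat -> R :=
  series (fun k => a ^+ k.+1 * (1 - expR (- (haar_rate theta k * t)))).

Definition escape_sum a theta t : R := limn (escape_series a theta t).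

Lemma escape_itv (u : R) : 0 <= u -> 0 <= 1 - expR (- u) <= 1.
Proof. by move=> u0; rewrite subr_ge0 expR_le1 oppr_le0 u0 gerBl expR_ge0. Qed.

Section Escape.
Variables a theta : R.
Hypotheses (a01 : 0 < a < 1) (theta0 : 0 < theta).
Let a0 : 0 < a. Proof. by have /andP[] := a01. Qed.
Let a1 : a < 1. Proof. by have /andP[] := a01. Qed.

Lemma escape_term_itv t k : 0 <= t ->
  0 <= a ^+ k.+1 * (1 - expR (- (haar_rate theta k * t))) <= a ^+ k.+1.
Proof.
move=> t0; have /andP[h0 h1] : 0 <= 1 - expR (- (haar_rate theta k * t)) <= 1.
  by apply: escape_itv; rewrite mulr_ge0// ltW// haar_rate_gt0.
have ak : 0 <= a ^+ k.+1 by rewrite exprn_ge0// ltW.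
by rewrite mulr_ge0//= ler_piMr.
Qed.

Lemma escape_cvg t : 0 <= t -> cvgn (escape_series a theta t).
Proof.
move=> t0; apply: (@series_le_cvg _ _ (geometric a a)) => [k|k|k|].
- by have /andP[] := escape_term_itv k t0.
- by rewrite /= -exprS exprn_ge0// ltW.
- by rewrite /= -exprS; have /andP[] := escape_term_itv k t0.
- by apply: is_cvg_geometric_series; rewrite gtr0_norm.
Qed.

Lemma escape_sum_le t (M : R) N : 0 <= t ->
  (forall n, (N <= n)%N -> escape_series a theta t n <= M) ->
  escape_sum a theta t <= M.
Proof.
move=> t0 uM; apply: limr_le; first exact: escape_cvg.
by exists N => // n /= /uM.
Qed.

Lemma escape_sum_ge t n : 0 <= t ->
  escape_series a theta t n <= escape_sum a theta t.
Proof.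
move=> t0; apply: nondecreasing_cvgn_le; last exact: escape_cvg.
apply: nondecreasing_series => k _ _.
by have /andP[] := escape_term_itv k t0.
Qed.

(** * The regime a theta < 1: linear behaviour at 0 *)

Section Linear.
Hypothesis atheta1 : a * theta < 1.

Let rate_series : nat -> R := series (fun k => a ^+ k.+1 * haar_rate theta k).

Let rate_term_ge0 k : 0 <= a ^+ k.+1 * haar_rate theta k.
Proof. by rewrite mulr_ge0 ?exprn_ge0 ?ltW ?haar_rate_gt0. Qed.

Lemma rate_seriesE n : (1 - a) * rate_series n =
  (2 - a) * (\sum_(0 <= k < n) (a * theta) ^+ k.+1) -
  a ^+ n.+1 * \sum_(1 <= j < n.+1) theta ^+ j.
Proof.
rewrite /rate_series /series/=; elim: n => [|n IHn].
  by rewrite !big_geq//; ring.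
rewrite !(big_nat_recr n)//= !mulrDr IHn (@big_nat_recr _ _ _ n.+1)//=.
by rewrite /haar_rate exprMn !exprS; ring.
Qed.

Let at0 : 0 < a * theta. Proof. exact: mulr_gt0. Qed.

Lemma sum_geometric_cvg :
  \sum_(0 <= k < n) (a * theta) ^+ k.+1 @[n --> \oo] -->
    a * theta / (1 - a * theta).
Proof.
have := @cvg_geometric_series R (a * theta) (a * theta).
rewrite gtr0_norm// => /(_ atheta1); apply: cvg_trans.
by rewrite /series/=; under eq_fun do under eq_bigr do rewrite exprS.
Qed.

(** Dropping the boundary term in [rate_seriesE] bounds the increasing partial sums, so they
    converge. The terms of the series then tend to 0, and they dominate the boundary term, which
    identifies the limit whether or not theta exceeds 1. *)
Lemma rate_series_cvg : rate_series n @[n --> \oo] -->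
  (2 - a) / (1 - a) * (a * theta / (1 - a * theta)).
Proof.
have a1' : 1 - a != 0 by have := a1; lra.
have rE n : rate_series n =
    (2 - a) / (1 - a) * (\sum_(0 <= k < n) (a * theta) ^+ k.+1) -
    a ^+ n.+1 * (\sum_(1 <= j < n.+1) theta ^+ j) / (1 - a).
  by apply: (mulfI a1'); rewrite rate_seriesE; field.
have crate : cvgn rate_series.
  apply: nondecreasing_is_cvgn.
    by apply: nondecreasing_series => k _ _; exact: rate_term_ge0.
  exists ((2 - a) / (1 - a) * (a * theta / (1 - a * theta))) => _ [n _ <-].
  rewrite rE.
  have s0 : 0 <= a ^+ n.+1 * (\sum_(1 <= j < n.+1) theta ^+ j) / (1 - a).
    rewrite divr_ge0 ?mulr_ge0 ?exprn_ge0 ?(ltW a0)//; last by have := a1; lra.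
    by apply: sumr_ge0 => j _; rewrite exprn_ge0 ?(ltW theta0).
  rewrite -[leRHS]subr0 lerB// ler_wpM2l//.
    by rewrite divr_ge0; have := a1; lra.
  rewrite ler_pdivlMr; last by rewrite subr_gt0.
  have := sum_exprS (a * theta) (leq0n n); rewrite expr1 => h.
  by rewrite mulrC -opprB mulNr h opprB gerBl exprn_ge0 ?(ltW at0).
have r0 :
    a ^+ n.+1 * (\sum_(1 <= j < n.+1) theta ^+ j) / (1 - a) @[n --> \oo] --> 0.
  rewrite -[X in _ --> X](mul0r (1 - a)^-1); apply: cvgM; last exact: cvg_cst.
  apply: (@squeeze_cvgr _ _ _ _ (fun=> 0)
    (fun n => a ^+ n.+1 * haar_rate theta n)).
  - near=> n.
    have s0 : 0 <= \sum_(1 <= j < n.+1) theta ^+ j.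
      by apply: sumr_ge0 => j _; rewrite exprn_ge0 ?(ltW theta0).
    rewrite mulr_ge0 ?exprn_ge0 ?(ltW a0)//= ler_wpM2l ?exprn_ge0 ?(ltW a0)//.
    by rewrite /haar_rate lerDl mulr_ge0 ?exprn_ge0 ?(ltW theta0).
  - exact: cvg_cst.
  - exact: cvg_series_cvg_0.
rewrite -[X in _ --> X]subr0 (_ : rate_series = fun n =>
    (2 - a) / (1 - a) * (\sum_(0 <= k < n) (a * theta) ^+ k.+1) -
    a ^+ n.+1 * (\sum_(1 <= j < n.+1) theta ^+ j) / (1 - a)); last exact/funext.
apply: cvgB => //; apply: cvgM; [exact: cvg_cst|exact: sum_geometric_cvg].
Unshelve. all: by end_near.
Qed.

Lemma escape_sum_linear (e : R) : 0 < e -> \forall t \near 0^'+,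
  `|escape_sum a theta t - (2 - a) / (1 - a) * (a * theta / (1 - a * theta)) * t|
  <= e * t.
Proof.
move=> e0; set B := _ / _ * _.
have rB n : rate_series n <= B.
  rewrite /B -(cvg_lim _ rate_series_cvg)//; apply: nondecreasing_cvgn_le.
    by apply: nondecreasing_series => k _ _; exact: rate_term_ge0.
  by apply/cvg_ex; exists B; exact: rate_series_cvg.
have [N _ /(_ N (leqnn N)) /= BN] :
    \forall n \near \oo, `|B - rate_series n| <= e / 2.
  by move/cvgrPdist_le : rate_series_cvg; apply; rewrite divr_gt0.
(* The quadratic errors are collected over the first N terms only: the full sum of a^k mu_k^2 may
   diverge. The lower bound needs no more, as the rest of the derivative is at most e / 2. *)
pose C := \sum_(0 <= k < N) a ^+ k.+1 * haar_rate theta k ^+ 2.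
have C0 : 0 <= C.
  by apply: sumr_ge0 => k _;
    rewrite mulr_ge0 ?exprn_ge0 ?(ltW a0) ?ltW ?haar_rate_gt0.
near=> t.
have t0 : 0 < t by near: t; exact: nbhs_right_gt.
have tC : t <= e / 2 / (C + 1).
  by near: t; apply: nbhs_right_le; rewrite !divr_gt0// ltr_pwDr.
have te k : haar_rate theta k * t - (haar_rate theta k * t) ^+ 2 <=
    1 - expR (- (haar_rate theta k * t)) <= haar_rate theta k * t.
  have /andP[] := expRN_le (mulr_ge0 (ltW (haar_rate_gt0 k theta0)) (ltW t0)).
  by move=> h1 h2; apply/andP; split; lra.
have ub : escape_sum a theta t <= B * t.
  apply: (@escape_sum_le _ _ 0%N) => [|n _]; first exact: ltW.
  rewrite (@le_trans _ _ (rate_series n * t))//.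
    2: by rewrite ler_wpM2r// ltW.
  rewrite /escape_series /rate_series /series/= mulr_suml.
  apply: ler_sum => k _.
  rewrite -mulrA ler_wpM2l ?exprn_ge0 ?(ltW a0)//.
  by have /andP[] := te k.
have lb : rate_series N * t - C * t ^+ 2 <= escape_sum a theta t.
  apply: le_trans (escape_sum_ge N (ltW t0)).
  rewrite /escape_series /rate_series /C /series/= !mulr_suml -sumrB.
  apply: ler_sum => k _.
  have -> : a ^+ k.+1 * haar_rate theta k * t -
      a ^+ k.+1 * haar_rate theta k ^+ 2 * t ^+ 2 =
    a ^+ k.+1 * (haar_rate theta k * t - (haar_rate theta k * t) ^+ 2) by ring.
  rewrite ler_wpM2l ?exprn_ge0 ?(ltW a0)//.
  by have /andP[] := te k.
have Ct : C * t <= e / 2.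
  rewrite (@le_trans _ _ (C * (e / 2 / (C + 1))))//; first by rewrite ler_wpM2l.
  have C1 : 0 < C + 1 by rewrite ltr_pwDr.
  rewrite [leLHS](_ : _ = e / 2 - e / 2 / (C + 1)).
    2: by field; rewrite gt_eqF.
  by rewrite gerBl !divr_ge0// ltW.
have Ct2 : C * t ^+ 2 <= e / 2 * t by rewrite expr2 mulrA ler_wpM2r ?(ltW t0).
have BNt : (B - rate_series N) * t <= e / 2 * t.
  by rewrite ler_wpM2r ?(ltW t0)// (le_trans (ler_norm _)).
rewrite distrC ger0_norm ?subr_ge0//.
have -> : e * t = e / 2 * t + e / 2 * t by field.
by move: BNt; rewrite mulrBl; lra.
Unshelve. all: by end_near.
Qed.
End Linear.

(** * The regime a theta > 1: power behaviour at 0 *)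

Section Power.
Hypothesis atheta1 : 1 < a * theta.

Let theta1 : 1 < theta.
Proof.
rewrite (lt_le_trans atheta1)// ler_piMl ?(ltW theta0)//.
exact: ltW.
Qed.

Lemma haar_rate_le k :
  haar_rate theta k <= ((theta - 1)^-1 + 2) * theta ^+ k.+1.
Proof.
have th1 : 0 < theta - 1 by rewrite subr_gt0.
rewrite /haar_rate [leRHS]mulrDl lerD2r mulrC ler_pdivlMr// mulrC.
rewrite big_add1/= sum_exprS//.
by rewrite gerBl exprn_ge0 ?(ltW theta0).
Qed.

(** At level N+1 the rate times t first exceeds a constant; the lower bound keeps that single term,
    where 1 - exp(- mu t) >= 1 - exp(-1). *)
Lemma escape_sum_scale :
  exists2 K, 0 < K & forall t N, 0 <= t ->
  theta ^+ N * t <= 1 < theta ^+ N.+1 * t ->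
  (1 - expR (-1)) * a ^+ N.+1 <= escape_sum a theta t <= K * a ^+ N.
Proof.
pose D : R := (theta - 1)^-1 + 2.
have D0 : 0 < D by rewrite addr_gt0// invr_gt0 subr_gt0.
have b1 : 0 < a * theta - 1 by rewrite subr_gt0.
have a1' : 0 < 1 - a by rewrite subr_gt0.
(* The first summand bounds the terms below index N, through 1 - exp(-u) <= u and a geometric sum of
   ratio a theta > 1; the second bounds the others by the tail of the powers of a. *)
exists (D * (a * theta / (a * theta - 1)) + a / (1 - a)).
  by rewrite addr_gt0// ?mulr_gt0 ?invr_gt0.
move=> t N t0 /andP[Nt NSt]; apply/andP; split.
  apply: le_trans (escape_sum_ge N.+1 t0).
  rewrite /escape_series /series/= big_nat_recr//= -[leLHS]add0r lerD//.
    by apply: sumr_ge0 => k _; have /andP[] := escape_term_itv k t0.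
  rewrite mulrC ler_wpM2l ?exprn_ge0 ?(ltW a0)// lerB// ler_expR lerN2.
  rewrite (le_trans (ltW NSt))// ler_wpM2r//; exact/ltW/haar_rate_gt.
apply: (@escape_sum_le _ _ N) => // n Nn.
rewrite /escape_series /series/= (big_cat_nat (leq0n N) Nn)//= mulrDl lerD//.
  apply: (@le_trans _ _ (\sum_(0 <= k < N) D * t * (a * theta) ^+ k.+1)).
    apply: ler_sum => k _.
    have -> : D * t * (a * theta) ^+ k.+1 = a ^+ k.+1 * (D * theta ^+ k.+1 * t).
      by rewrite exprMn; ring.
    rewrite ler_wpM2l ?exprn_ge0 ?(ltW a0)//.
    apply: (@le_trans _ _ (haar_rate theta k * t)).
      by have := expR_ge1Dx (- (haar_rate theta k * t)); lra.
    by rewrite ler_wpM2r// haar_rate_le.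
  rewrite -mulr_sumr -!mulrA ler_wpM2l ?(ltW D0)//.
  apply: (@le_trans _ _ (t * ((a * theta) ^+ N.+1 / (a * theta - 1)))).
    rewrite ler_wpM2l// ler_pdivlMr// mulrC sum_exprS// gerBl expr1.
    by rewrite (ltW (mulr_gt0 a0 theta0)).
  have -> : t * ((a * theta) ^+ N.+1 / (a * theta - 1)) =
      theta ^+ N * t * (a * (theta * ((a * theta - 1)^-1 * a ^+ N))).
    by rewrite exprMn !exprS; field; rewrite gt_eqF.
  rewrite ler_piMl// !mulr_ge0 ?invr_ge0 ?exprn_ge0 ?(ltW a0) ?(ltW theta0)//.
  exact: ltW.
apply: (@le_trans _ _ (\sum_(N <= k < n) a ^+ k.+1)).
  by apply: ler_sum => k _; have /andP[] := escape_term_itv k t0.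
rewrite mulrAC ler_pdivlMr// mulrC -opprB mulNr sum_exprS// opprB -exprS.
by rewrite gerBl exprn_ge0 ?(ltW a0).
Qed.

(** N is the predecessor of the least n with theta^n t > 1; this n is positive because t < 1. *)
Lemma scale_index t : 0 < t < 1 ->
  exists N, theta ^+ N * t <= 1 < theta ^+ N.+1 * t.
Proof.
move=> /andP[t0 t1].
have ex : exists n, 1 < theta ^+ n * t.
  have thV : 0 < theta^-1 < 1 by rewrite invr_gt0 theta0 invf_lt1.
  have [n _ /(_ n (leqnn n)) /= h] : \forall n \near \oo, `|theta^-1 ^+ n| < t.
    by move/cvgr0Pnorm_lt : (expr_cvg0 thV); exact.
  exists n; move: h; rewrite ger0_norm ?exprn_ge0 ?invr_ge0 ?(ltW theta0)//.
  by rewrite exprVn mulrC -ltr_pdivrMr ?exprn_gt0// mul1r.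
case: (ex_minnP ex) => [[|N]]; first by rewrite expr0 mul1r ltNge (ltW t1).
move=> h hmin; exists N; rewrite h andbT leNgt; apply/negP => /hmin.
by rewrite ltnn.
Qed.

(** Raising theta^N t <= 1 < theta^(N+1) t to the power beta gives a^(N+1) <= t^beta <= a^N; the
    mismatch of exponents costs a factor a in each constant. *)
Lemma escape_sum_powR (beta : R) : theta `^ beta = a^-1 -> 0 < beta ->
  exists2 c, 0 < c & exists2 K, 0 < K & forall t, 0 < t < 1 ->
  c * t `^ beta <= escape_sum a theta t <= K * t `^ beta.
Proof.
move=> thb b0; have [K K0 HK] := escape_sum_scale.
have e1 : 0 < 1 - expR (-1) :> R by rewrite subr_gt0 expR_lt1 ltrN10.
exists ((1 - expR (-1)) * a); first exact: mulr_gt0.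
exists (K / a); first exact: divr_gt0.
move=> t t01; have [N NP] := scale_index t01; have /andP[t0 t1] := t01.
have /andP[h1 h2] := HK _ _ (ltW t0) NP; case/andP: NP => N1 N2.
have powE n : (theta ^+ n * t) `^ beta = a ^- n * t `^ beta.
  rewrite powRM ?exprn_ge0 ?(ltW theta0) ?(ltW t0)//.
  rewrite -powR_mulrn ?(ltW theta0)// -powRrM [n%:R * _]mulrC powRrM thb.
  by rewrite powR_mulrn ?invr_ge0 ?(ltW a0)// exprVn.
have p1 : 1 `^ beta = 1 :> R by rewrite powR1.
have l1 : t `^ beta <= a ^+ N.
  rewrite -[leRHS]mulr1 -ler_pdivrMl ?exprn_gt0// -powE -[leRHS]p1.
  by apply: ge0_ler_powR;
    rewrite ?nnegrE ?mulr_ge0 ?exprn_ge0 ?(ltW theta0) ?(ltW t0) ?(ltW b0).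
have l2 : a ^+ N.+1 <= t `^ beta.
  rewrite -[leLHS]mulr1 -ler_pdivlMl ?exprn_gt0// -powE -[leLHS]p1.
  by apply: ge0_ler_powR;
    rewrite ?nnegrE ?mulr_ge0 ?exprn_ge0 ?(ltW theta0) ?(ltW t0) ?(ltW b0) ?(ltW N2).
apply/andP; split.
  by rewrite (le_trans _ h1)// -mulrA ler_wpM2l ?(ltW e1)//
    exprS ler_wpM2l ?(ltW a0).
by rewrite (le_trans h2)// -mulrA ler_wpM2l ?(ltW K0)// ler_pdivlMl// -exprS.
Qed.
End Power.
End Escape.
End Asymptotics.

(** * From the escape sum to the moment *)

(** Two sets of a proper filter always meet, so the infimum over one is at most the supremum over
    the other. *)
Lemma limf_einf_le_esup (R : realType) (q : R -> \bar R) (F : set_system R) :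
  ProperFilter F -> (limf_einf q F <= limf_esup q F)%E.
Proof.
move=> PF; rewrite limf_einfE limf_esupE.
apply: ge_ereal_sup => _ [V FV <-]; apply: le_ereal_inf_tmp => _ [W FW <-].
have [x [Vx Wx]] := filter_ex (filterI FV FW).
apply: (@le_trans _ _ (q x)).
  by apply: ereal_inf_lbound; exists x.
by apply: ereal_sup_ubound; exists x.
Qed.

Lemma powRN_itv (R : realType) (r : R) : 0 < r -> 0 < 3 `^ (- r) < 1.
Proof.
move=> r0; rewrite powR_gt0//= powRN invf_lt1 ?powR_gt0//.
rewrite -[ltLHS](_ : 1 `^ r = 1 :> R); last by rewrite powR1.
by apply: gt0_ltr_powR; rewrite ?nnegrE ?ltr1n.
Qed.

Lemma moment_escape_sum (R : realType) (theta r : R) (d : measure_display)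
    (Omega : measurableType d) (P : cantor_space -> probability Omega R)
    (X : R -> Omega -> cantor_space) (x : cantor_space) (t : R) :
  0 < theta -> 0 < r -> is_SSS 1 theta P X -> 0 <= t ->
  let a := 3 `^ (- r) in
  moment P X r x t = ((1 - a) / (2 - a) * escape_sum a theta t)%:E.
Proof.
move=> theta0 r0 [T FP genT] t0 a.
have a01 : 0 < a < 1.
  exact: powRN_itv.
rewrite (moment_series FP)//.
rewrite -(@nneseries_addn _ _ 1%N) => [|k]; last first.
  by apply: mule_ge0 => //; rewrite lee_fin powR_ge0.
under eq_eseriesr => k _.
  rewrite addn1; have [_ ->] := separation_process FP x k t0.
  rewrite -mulNr powRrM powR_mulrn ?powR_ge0// -EFinM; over.
have := cvg_sum_halving a01 (survival0 FP x t0)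
  (fun k => survival_itv FP x k t0)
  (fun k => survivalS FP theta0 genT x k t0) (escape_cvg a01 theta0 t0).
rewrite -/(escape_sum a theta t) => h.
rewrite -(cvg_lim _ h)// -EFin_lim; last by apply/cvg_ex; eexists; exact: h.
by congr (limn _); apply/funext => n; rewrite /series /= sumEFin.
Qed.

Theorem theorem6 (R : realType) (theta r : R) (d : measure_display)
    (Omega : measurableType d) (P : cantor_space -> probability Omega R)
    (X : R -> Omega -> cantor_space)
    (theta_gt0 : 0 < theta) (r_gt0 : 0 < r) (X_SSS : is_SSS 1 theta P X) :
  (forall (x : cantor_space) (t : R), 0 <= t ->
     moment P X r x t \is a fin_num /\
     moment P X r x t =
       (\sum_(1 <= k <oo)
          (3 `^ (- (r * k%:R)))%:E *
          P x [set w | separation_index x (X t w) = k])%E) /\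
  (forall (x y : cantor_space) (t : R), 0 <= t ->
     moment P X r x t = moment P X r y t) /\
  (forall x : cantor_space,
     (theta < 3 `^ r ->
        let S := fun n : nat =>
          \sum_(1 <= k < n) 3 `^ (- (r * k%:R)) * theta ^+ k in
        cvgn S /\
        exists2 e : R -> R, e =o_ (0^'+) (id : R -> R) &
          forall t : R, 0 <= t ->
            fine (moment P X r x t) = limn S * (t + e t)) /\
     (3 `^ r < theta ->
        let q := fun t : R =>
          (fine (moment P X r x t) / t `^ (ln 3 / ln theta * r))%:E in
        [/\ (0 < limf_einf q 0^'+)%E,
            (limf_einf q 0^'+ <= limf_esup q 0^'+)%E &
            (limf_esup q 0^'+ < +oo)%E])).
Proof.
pose a : R := 3 `^ (- r).
have a01 : 0 < a < 1.
  exact: powRN_itv.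
have [a0 a1] := andP a01.
have momentE x t : 0 <= t ->
    moment P X r x t = ((1 - a) / (2 - a) * escape_sum a theta t)%:E.
  exact: moment_escape_sum.
have aV : 3 `^ r = a^-1 by rewrite /a powRN invrK.
pose c := (1 - a) / (2 - a); have c0 : 0 < c by rewrite divr_gt0; lra.
split; [|split].
- move=> x t t0; split; first by rewrite momentE.
  by have [T FP _] := X_SSS; rewrite (moment_series FP).
- by move=> x y t t0; rewrite !momentE.
move=> x; rewrite aV; split.
  rewrite -[a^-1]mul1r ltr_pdivlMr// mulrC => at1 S.
  have at0 : 0 < a * theta by rewrite mulr_gt0.
  pose L := a * theta / (1 - a * theta).
  have L0 : 0 < L by rewrite divr_gt0// subr_gt0.
  have SL : S n @[n --> \oo] --> L.
    rewrite -cvg_shiftS; apply: cvg_trans (sum_geometric_cvg a01 theta_gt0 at1).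
    rewrite (_ : (fun n => S n.+1) =
      fun n => \sum_(0 <= k < n) (a * theta) ^+ k.+1)//.
    apply/funext => n; rewrite /S big_add1/=; apply: eq_bigr => k _.
    by rewrite -mulNr powRrM powR_mulrn ?powR_ge0// exprMn.
  split; first by apply/cvg_ex; exists L.
  rewrite (cvg_lim _ SL)//.
  (* The error function is forced by the required equation, L being nonzero. *)
  exists (fun t => c * escape_sum a theta t / L - t); last first.
    by move=> t t0; rewrite momentE//= subrKC [RHS]mulrC divfK ?gt_eqF.
  apply/eqoP => e e0.
  have e'0 : 0 < e * L / c by rewrite divr_gt0// mulr_gt0.
  have := escape_sum_linear a01 theta_gt0 at1 e'0.
  apply: filter_app; near=> t => h.
  have t0 : 0 < t by near: t; exact: nbhs_right_gt.
  rewrite (gtr0_norm t0).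
  have a1' : 1 - a != 0 by rewrite subr_eq0 gt_eqF.
  have a2' : 2 - a != 0 by lra.
  (* The factor c = (1 - a) / (2 - a) cancels the constant (2 - a) / (1 - a) of the linear term,
     leaving exactly the slope L. *)
  have -> : c * escape_sum a theta t / L - t =
      c / L * (escape_sum a theta t - (2 - a) / (1 - a) * L * t).
    by rewrite /c; field; rewrite a1' a2' gt_eqF.
  have cL : 0 < c / L by rewrite divr_gt0.
  rewrite normrM (gtr0_norm cL) -ler_pdivlMl//.
  apply: le_trans h _; rewrite le_eqVlt; apply/orP; left; apply/eqP.
  by field; rewrite !gt_eqF.
rewrite -[a^-1]mul1r ltr_pdivrMr// mulrC => at1 q.
have theta1 : 1 < theta.
  by rewrite (lt_le_trans at1)// ler_piMl// ltW.
pose beta := ln 3 / ln theta * r.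
have lnth : 0 < ln theta by rewrite ln_gt0.
have ln3 : 0 < ln 3 :> R by rewrite ln_gt0// ltr1n.
have beta0 : 0 < beta by rewrite mulr_gt0// divr_gt0.
have thb : theta `^ beta = a^-1.
  rewrite -aV /powR !gt_eqF//; congr expR.
  by rewrite /beta; field; rewrite gt_eqF.
have [C1 C10 [C2 C20 CE]] := escape_sum_powR a01 theta_gt0 at1 thb beta0.
have qE : \forall t \near 0^'+, ((c * C1)%:E <= q t <= (c * C2)%:E)%E.
  near=> t.
  have t01 : 0 < t < 1.
    by apply/andP; split; near: t; [exact: nbhs_right_gt|exact: nbhs_right_lt].
  have /andP[t0 _] := t01; have /andP[l u] := CE t t01.
  have tb : 0 < t `^ beta by rewrite powR_gt0.
  rewrite /q momentE ?(ltW t0)//= -/beta -/c !lee_fin.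
  rewrite ler_pdivlMr// ler_pdivrMr//.
  by rewrite -!(mulrA c) !(ler_pM2l c0) l u.
(* This one set of the filter bounds both the lower and the upper limit. *)
pose V := [set t | (c * C1)%:E <= q t <= (c * C2)%:E]%E.
split; last 2 first.
- exact: limf_einf_le_esup.
- rewrite limf_esupE (@le_lt_trans _ _ (c * C2)%:E) ?ltry//.
  apply: ge_ereal_inf; exists (ereal_sup (q @` V)).
    by exists V.
  by apply: ge_ereal_sup => _ [t /= /andP[_ h] <-].
rewrite limf_einfE (@lt_le_trans _ _ (c * C1)%:E) ?lte_fin//.
  exact: mulr_gt0.
apply: le_ereal_sup_tmp; exists (ereal_inf (q @` V)).
  by exists V.
by apply: le_ereal_inf_tmp => _ [t /= /andP[h _] <-].
Unshelve. all: by end_near.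
Qed.
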